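(* Let $k$ be a field and $n\ge1$. For any representation $L$ over $k$ of the type-$B$ Artin group $B_n$, there is an isomorphism of chain complexes $$D(n)_*\otimes L\;\cong\; C(n+1)_{*+2}\otimes\mathrm{Ind}^{A_{n+1}}_{B_n}(L).$$
   Context: Groups. $A_{n+1}$ is the braid group on $n+1$ strands with generators $\sigma_1,\dots,\sigma_n$; for $a\in A_{n+1}$, $\underline a\in S_{n+1}$ is the underlying permutation, with $\underline{\sigma_i}=(i\ i{+}1)$ and $\underline{ab}=\underline a\circ\underline b$. $B_n$ is identified with the subgroup of braids with $\underline a(n+1)=n+1$ (generated by $\sigma_1,\dots,\sigma_{n-1}$ and $\tau_n=\sigma_n^2$). Put $\alpha_i=\sigma_i\sigma_{i+1}\cdots\sigma_n$ for $1\le i\le n$ and $\alpha_{n+1}=\mathrm{id}$; these represent the left cosets of $B_n$. $\mathrm{Ind}^{A_{n+1}}_{B_n}(L)=k[A_{n+1}]\otimes_{k[B_n]}L$. For $1\le i\le n+1$ define $\eta_i:A_{n+1}\to B_n$ by $\eta_i(a)=\alpha_{\underline a(i)}^{-1}\,a\,\alpha_i$. Shuffles. A $(p,q)$-shuffle is a permutation in $S_{p+q}$ preserving order on the first $p$ and the last $q$ elements; $(-1)^{|\gamma|}$ is its sign; its lift $\tilde\gamma\in A_{p+q}$ is the positive permutation braid ($\tilde\gamma=\sigma_{i_1}\cdots\sigma_{i_r}$ for a reduced expression $\gamma=s_{i_1}\cdots s_{i_r}$). A $(p,(q,h),j)$-shuffle ($0\le h\le q$, $0\le j\le p-1$) is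 a $(p,q)$-shuffle sending $j+1$ to $j+h+1$; a $((p,h),q,j)$-shuffle ($0\le h\le p$, $0\le j\le q-1$) is a $(p,q)$-shuffle sending $p+j+1$ to $h+j+1$. Whenever a shuffle $\gamma$ of the points in the $m$-th and $(m+1)$-st parts of a composition $\lambda$ of $N$ occurs, $\tilde\gamma$ denotes its lift to the copy $A_{\lambda_m+\lambda_{m+1}}\le A_N$ of braids nontrivial only on the $\lambda_m+\lambda_{m+1}$ strands starting with strand number $\lambda_1+\dots+\lambda_{m-1}+1$. Write $\rho^m$ for the composition obtained from $\lambda$ by replacing $\lambda_m,\lambda_{m+1}$ with $\lambda_m+\lambda_{m+1}$. The complex $C(N)_*\otimes T$ for an $A_N$-representation $T$: $C(N)_q$ is free abelian on compositions $\lambda$ of $N$ with $q-N$ parts, and $d(\lambda\otimes t)=\sum_{m=1}^{q-N-1}(-1)^{m-1}\rho^m\otimes\sum_\gamma(-1)^{|\gamma|}\tilde\gamma(t)$, $\gamma$ over all $(\lambda_m,\lambda_{m+1})$-shuffles. The complex $D(n)_*\otimes L$: $D(n)_q$ is free abelian on triples $(\lambda,i,j)$ with $\lambda$ a composition of $n+1$ with $l(\lambda)=q-n+1$ parts, $1\le i\le l(\lambda)$, $0\le j\le\lambda_i-1$. With $\iota=j+1+\sum_{m=1}^{i-1}\lambda_m$, the differential is $$\begin{aligned}d[(\lambda,i,j)\otimes\ell]&=\sum_{m=1}^{i-2}(-1)^{m-1}(\rho^m,i-1,j)\otimes\sum_{\gamma}(-1)^{|\gamma|}\eta_\iota(\tilde\gamma)(\ell)+\sum_{m=i+1}^{q-n}(-1)^{m-1}(\rho^m,i,j)\otimes\sum_{\gamma}(-1)^{|\gamma|}\eta_\iota(\tilde\gamma)(\ell)\\&+(-1)^{i-2}\sum_{h=0}^{\lambda_{i-1}}(\rho^{i-1},i-1,j+h)\otimes\sum_{\gamma'}(-1)^{|\gamma'|}\eta_\iota(\tilde\gamma')(\ell)+(-1)^{i-1}\sum_{h=0}^{\lambda_{i+1}}(\rho^{i},i,j+h)\otimes\sum_{\gamma''}(-1)^{|\gamma''|}\eta_\iota(\tilde\gamma'')(\ell),\end{aligned}$$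 where $\gamma$ runs over $(\lambda_m,\lambda_{m+1})$-shuffles, $\gamma'$ over $((\lambda_{i-1},h),\lambda_i,j)$-shuffles, $\gamma''$ over $(\lambda_i,(\lambda_{i+1},h),j)$-shuffles; the third (fourth) term is absent if $i=1$ (if $i=l(\lambda)$). *)

(* Defs.v *)
From HB Require Import structures.
From mathcomp Require Import all_boot all_order all_fingroup all_algebra.
From mathcomp Require Import generic_quotient ring_quotient finmap boolp.
From mathcomp Require Import zify.
From mathcomp.multinomials Require Import monalg.

Set Implicit Arguments.
Unset Strict Implicit.
Unset Printing Implicit Defensive.

Import GRing.Theory.

Local Open Scope quotient_scope.
Local Open Scope ring_scope.

(* Strands, generators and parts of compositions are numbered from 0: [adj m i]
   and [sigma N i] below are the usual s_{i+1} and sigma_{i+1}, and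
   [alpha n i], [eta n i a] are alpha_{i+1}, eta_{i+1}(a). *)
Definition adj (m i : nat) : 'S_m :=
  match insub i, insub i.+1 with
  | Some a, Some b => tperm a b
  | _, _ => 1%g
  end.

(* MathComp permutations compose as [(s * t) x = t (s x)]; hence the reversed
   product: [word_perm m [:: i; j]] is the function composite s_i \o s_j. *)
Definition word_perm m (w : seq nat) : 'S_m :=
  foldr (fun i g => (g * adj m i)%g) 1%g w.

Definition valid_word m (w : seq nat) := all (fun i => i.+1 < m)%N w.

Definition reduced m (g : 'S_m) (w : seq nat) : Prop :=
  [/\ valid_word m w, word_perm m w = g &
      forall w', valid_word m w' -> word_perm m w' = g -> (size w <= size w')%N].

Lemma word_perm_cat m w1 w2 :
  word_perm m (w1 ++ w2) = (word_perm m w2 * word_perm m w1)%g.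
Proof. by elim: w1 => [|i w1 IH] /=; rewrite ?mulg1 // IH mulgA. Qed.

Lemma adjE m i (a b : 'I_m) : val a = i -> val b = i.+1 -> adj m i = tperm a b.
Proof.
move=> ai bi; rewrite /adj.
have -> : insub i = Some a by rewrite -ai valK.
by have -> : insub i.+1 = Some b by rewrite -bi valK.
Qed.

Lemma word_exists m (g : 'S_m) : exists w, valid_word m w /\ word_perm m w = g.
Proof.
pose expr (h : 'S_m) := exists w, valid_word m w /\ word_perm m w = h.
have exprM h1 h2 : expr h1 -> expr h2 -> expr (h1 * h2)%g.
  move=> [w1 [v1 <-]] [w2 [v2 <-]]; exists (w2 ++ w1).
  by rewrite word_perm_cat /valid_word all_cat; split=> //; apply/andP.
have expr1 : expr 1%g by exists [::].
have exprT d : forall a b : 'I_m, (val b = val a + d)%N -> expr (tperm a b).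
  elim: d => [|d IH] a b bE.
    have -> : b = a by apply/val_inj; rewrite bE addn0.
    by rewrite tperm1.
  have cm : (a + d < m)%N.
    by apply: leq_ltn_trans (ltn_ord b); rewrite bE leq_add2l.
  pose c := Ordinal cm.
  have exprcb : expr (tperm c b).
    exists [:: (a + d)%N]; split; first by rewrite /valid_word /= andbT -addnS -bE; exact: ltn_ord.
    by rewrite /= mul1g; apply: adjE => //; rewrite bE addnS.
  case: (eqVneq d 0%N) => [d0|dn0].
    by have <- : c = a by apply/val_inj; rewrite /= d0 addn0.
  have ca : c != a by rewrite -val_eqE /= -{2}[val a]addn0 eqn_add2l.
  have ba : b != a by rewrite -val_eqE bE -{2}[val a]addn0 eqn_add2l.
  have <- : (tperm a c ^ tperm c b)%g = tperm a b by rewrite tpermJ tpermL tpermD.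
  rewrite conjgE tpermV.
  exact: (exprM _ _ exprcb (exprM _ _ (IH a c erefl) exprcb)).
have exprT' a b : expr (tperm a b).
  case: (leqP a b) => ab; first by apply: (exprT (b - a)%N); rewrite subnKC.
  by rewrite tpermC; apply: (exprT (a - b)%N); rewrite subnKC // ltnW.
have [ts -> _] := prod_tpermP g.
by elim: ts => [|t ts IH]; rewrite ?big_nil // big_cons; apply: exprM.
Qed.

Lemma reduced_exists m (g : 'S_m) : exists w, reduced g w.
Proof.
pose P l := `[< exists w, [/\ valid_word m w, word_perm m w = g & size w = l] >].
have exP : exists l, P l.
  by have [w [vw wg]] := word_exists g; exists (size w); apply/asboolP; exists w.
case: (ex_minnP exP) => l /asboolP [w [vw wg <-]] lmin.
exists w; split=> // w' vw' w'g; apply: lmin.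
by apply/asboolP; exists w'.
Qed.

(* By Matsumoto's theorem the positive lift does not depend on this choice. *)
Definition reduced_word m (g : 'S_m) : seq nat := projT1 (cid (reduced_exists g)).

Section BraidGroup.
Variable N : nat.

(* A letter [(i, false)] stands for sigma_i and [(i, true)] for its inverse. *)
Definition bword := seq ('I_N.-1 * bool).

Inductive braid_rel : bword -> bword -> Prop :=
| BraidRefl u : braid_rel u u
| BraidSym u v : braid_rel u v -> braid_rel v u
| BraidTrans u v w : braid_rel u v -> braid_rel v w -> braid_rel u w
| BraidCat u u' v v' :
    braid_rel u u' -> braid_rel v v' -> braid_rel (u ++ v) (u' ++ v')
| BraidInv i b : braid_rel [:: (i, b); (i, ~~ b)] [::]
| BraidFar (i j : 'I_N.-1) : (i.+1 < j)%N ->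
    braid_rel [:: (i, false); (j, false)] [:: (j, false); (i, false)]
| BraidNear (i j : 'I_N.-1) : val j = i.+1 ->
    braid_rel [:: (i, false); (j, false); (i, false)]
              [:: (j, false); (i, false); (j, false)].

Definition braid_eqb : rel bword := fun u v => `[< braid_rel u v >].

Lemma braid_eqb_equiv : equiv_class_of braid_eqb.
Proof.
split=> [u|u v|v u w]; first exact/asboolP/BraidRefl.
  by apply/asboolP/asboolP; apply: BraidSym.
move=> /asboolP uv /asboolP vw; apply/asboolP; exact: BraidTrans uv vw.
Qed.

Canonical braid_equiv := EquivRelPack braid_eqb_equiv.
Canonical braid_encModRel := defaultEncModRel braid_eqb.

Definition braid := {eq_quot braid_eqb}.
HB.instance Definition _ : EqQuotient bword braid_eqb braid := EqQuotient.on braid.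
HB.instance Definition _ := Choice.on braid.

Definition braid_of (w : bword) : braid := \pi_braid w.

Lemma braid_ofP u v : braid_of u = braid_of v <-> braid_rel u v.
Proof.
split=> [/eqP|uv]; first by rewrite /braid_of eqmodE => /asboolP.
by apply/eqP; rewrite /braid_of eqmodE; apply/asboolP.
Qed.

Lemma braid_ofK a : braid_of (repr a) = a.
Proof. exact: reprK. Qed.

Definition inv_word (w : bword) : bword := rev [seq (x.1, ~~ x.2) | x <- w].

Lemma inv_wordK : involutive inv_word.
Proof.
move=> w; rewrite /inv_word map_rev revK -map_comp -[RHS]map_id.
by apply: eq_map => -[i b] /=; rewrite negbK.
Qed.

Lemma braid_rel_invr w : braid_rel (w ++ inv_word w) [::].
Proof.
elim: w => [|[i b] w IH]; first exact: BraidRefl.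
have -> : ((i, b) :: w) ++ inv_word ((i, b) :: w)
    = [:: (i, b)] ++ ((w ++ inv_word w) ++ [:: (i, ~~ b)]).
  by rewrite /inv_word /= rev_cons -cats1 catA.
apply: BraidTrans (BraidInv i b).
exact: (BraidCat (BraidRefl [:: (i, b)]) (BraidCat IH (BraidRefl [:: (i, ~~ b)]))).
Qed.

Lemma braid_rel_inv u v : braid_rel u v -> braid_rel (inv_word u) (inv_word v).
Proof.
move=> uv; have r := BraidRefl.
apply: (@BraidTrans _ (inv_word u ++ (v ++ inv_word v))).
  rewrite -[X in braid_rel X _]cats0; apply: BraidCat => //.
  exact/BraidSym/braid_rel_invr.
apply: (@BraidTrans _ ((inv_word u ++ u) ++ inv_word v)).
  rewrite catA; apply: BraidCat => //; apply: BraidCat => //; exact: BraidSym.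
rewrite -[X in braid_rel _ X]cat0s; apply: BraidCat => //.
by rewrite -{2}[u]inv_wordK; apply: braid_rel_invr.
Qed.

Definition braid_one : braid := braid_of [::].
Definition braid_mul (a b : braid) : braid := braid_of (repr a ++ repr b).
Definition braid_inv (a : braid) : braid := braid_of (inv_word (repr a)).

Lemma braid_repr w : braid_rel (repr (braid_of w)) w.
Proof. by apply/braid_ofP; rewrite braid_ofK. Qed.

Lemma braid_mulE u v : braid_mul (braid_of u) (braid_of v) = braid_of (u ++ v).
Proof. by apply/braid_ofP/BraidCat; apply: braid_repr. Qed.

Lemma braid_invE u : braid_inv (braid_of u) = braid_of (inv_word u).
Proof. by apply/braid_ofP/braid_rel_inv/braid_repr. Qed.

Lemma braid_mulA : associative braid_mul.
Proof.
move=> a b c; rewrite -[a]braid_ofK -[b]braid_ofK -[c]braid_ofK.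
by rewrite !braid_mulE catA.
Qed.

Lemma braid_mul1 : left_id braid_one braid_mul.
Proof. by move=> a; rewrite -[a]braid_ofK braid_mulE. Qed.

Lemma braid_mulr1 : right_id braid_one braid_mul.
Proof. by move=> a; rewrite -[a]braid_ofK braid_mulE cats0. Qed.

Lemma braid_mulV : right_inverse braid_one braid_inv braid_mul.
Proof.
move=> a; rewrite -[a]braid_ofK braid_invE braid_mulE.
exact/braid_ofP/braid_rel_invr.
Qed.

Lemma braid_mulVl : left_inverse braid_one braid_inv braid_mul.
Proof.
move=> a; rewrite -[a]braid_ofK braid_invE braid_mulE; apply/braid_ofP.
by rewrite -{2}[repr a]inv_wordK; apply: braid_rel_invr.
Qed.

HB.instance Definition _ := isGroup.Build braid
  braid_mulA braid_mul1 braid_mulr1 braid_mulVl braid_mulV.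

Lemma braid_ofM u v : (braid_of u * braid_of v)%g = braid_of (u ++ v).
Proof. exact: braid_mulE. Qed.

Definition sigma (i : nat) : braid :=
  if insub i is Some j then braid_of [:: (j, false)] else 1%g.

Definition bword_perm (w : bword) : 'S_N := word_perm N [seq val x.1 | x <- w].

Definition bperm (a : braid) : 'S_N := bword_perm (repr a).

Lemma bword_perm_rel u v : braid_rel u v -> bword_perm u = bword_perm v.
Proof.
have ordN (i : 'I_N.-1) : (i.+1 < N)%N.
  by move: (ltn_ord i); lia.
have ordN' (i : 'I_N.-1) : (i < N)%N by apply: ltnW; apply: ordN.
have adjO (i : 'I_N.-1) : adj N i = tperm (Ordinal (ordN' i)) (Ordinal (ordN i)).
  exact: adjE.
have neq (x y : 'I_N) : nat_of_ord x <> y -> x != y.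
  by move=> xy; apply/eqP => e; rewrite e in xy.
elim=> {u v} //.
- by move=> u v w _ -> _ ->.
- by move=> u u' v v' _ Hu _ Hv; rewrite /bword_perm !map_cat !word_perm_cat
    -/(bword_perm u) -/(bword_perm v) Hu Hv.
- by move=> i b; rewrite /bword_perm /= mul1g adjO tperm2.
- move=> i j ij; rewrite /bword_perm /= !mul1g !adjO conjgC tpermJ.
  by rewrite !tpermD //; apply: neq => /=; lia.
- move=> i j /= ij; rewrite /bword_perm /= !mul1g !adjO.
  have tpermJr (a b c d : 'I_N) :
      (tperm a b * tperm c d * tperm a b = tperm c d ^ tperm a b)%g.
    by rewrite conjgE tpermV mulgA.
  rewrite !tpermJr !tpermJ.
  have <- : Ordinal (ordN i) = Ordinal (ordN' j) by apply/val_inj; rewrite /= ij.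
  by rewrite tpermL tpermR !tpermD //; apply: neq => /=; lia.
Qed.

Lemma bpermE w : bperm (braid_of w) = bword_perm w.
Proof. exact/bword_perm_rel/braid_repr. Qed.

Lemma bpermM a b : bperm (a * b)%g = (bperm b * bperm a)%g.
Proof.
rewrite -[a]braid_ofK -[b]braid_ofK braid_ofM !bpermE.
by rewrite /bword_perm map_cat word_perm_cat.
Qed.

Lemma bperm1 : bperm 1%g = 1%g.
Proof. by rewrite -[1%g]/(braid_of [::]) bpermE. Qed.

Lemma bpermV a : bperm a^-1%g = (bperm a)^-1%g.
Proof. by apply: (mulgI (bperm a)); rewrite -bpermM mulVg mulgV bperm1. Qed.

Lemma bperm_sigma i : bperm (sigma i) = adj N i.
Proof.
rewrite /sigma; case: insubP => [j _ <-|Ni]; first by rewrite bpermE /bword_perm /= mul1g.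
rewrite bperm1 /adj; case: insubP => // x _ _; case: insubP => // y yN _; lia.
Qed.

End BraidGroup.

(* The positive lift of a permutation of [m] consecutive strands, in the copy
   of the braid group on these strands starting at strand [off]. *)
Definition lift N off m (g : 'S_m) : braid N :=
  (\prod_(i <- reduced_word g) sigma N (off + i))%g.

Section TypeB.
Variable n : nat.

Definition typeB_pred : {pred braid n.+1} := fun a => bperm a ord_max == ord_max.

Definition typeB := {a : braid n.+1 | typeB_pred a}.

Lemma typeB_closed : group_closed typeB_pred.
Proof.
split=> [|a b]; rewrite !unfold_in ?bperm1 ?perm1 //.
move=> /eqP ha /eqP hb; rewrite bpermM bpermV permM.
by rewrite -{1}hb permK ha.
Qed.

HB.instance Definition _ := SubChoice.on typeB.
HB.instance Definition _ := SubChoice_isSubGroup.Build (braid n.+1) typeB_pred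
  typeB typeB_closed.

Definition alpha (i : nat) : braid n.+1 := (\prod_(i <= l < n) sigma n.+1 l)%g.

Lemma bperm_alpha (i : 'I_n.+1) : bperm (alpha i) ord_max = i.
Proof.
rewrite /alpha; move e: (n - i)%N => d; elim: d i e => [|d IH] i e.
  rewrite big_geq ?bperm1 ?perm1; last by move: (ltn_ord i); lia.
  by apply/val_inj => /=; move: (ltn_ord i); lia.
have ltin : (i < n)%N by lia.
rewrite big_ltn // bpermM permM.
have lti : (i.+1 < n.+1)%N by [].
rewrite (IH (Ordinal lti)) /=; last by lia.
by rewrite bperm_sigma (@adjE _ i i (Ordinal lti)) // tpermR.
Qed.

Lemma eta_subproof (i : 'I_n.+1) (a : braid n.+1) :
  typeB_pred ((alpha (bperm a i))^-1 * a * alpha i)%g.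
Proof.
rewrite /typeB_pred !bpermM bpermV !permM bperm_alpha.
by apply/eqP; rewrite -[X in _ X = _]bperm_alpha permK.
Qed.

Definition eta (i : 'I_n.+1) (a : braid n.+1) : typeB :=
  Sub ((alpha (bperm a i))^-1 * a * alpha i)%g (eta_subproof i a).

End TypeB.

Record representation (k : fieldType) (G : groupType) (V : lmodType k) :=
  Representation {
    rep_act :> G -> {linear V -> V};
    rep_act1 : forall v, rep_act 1%g v = v;
    rep_actM : forall g h v, rep_act (g * h)%g v = rep_act g (rep_act h v)
  }.

(* [{malg k[X]}] is the k-module of finitely supported functions X -> k, with
   basis elements [<< x >>]; [malg_lin f] is the linear extension of [f]. *)
Section LinearExtension.
Variables (k : fieldType) (X : choiceType) (V : lmodType k).

Definition malg_lin (f : X -> V) (z : {malg k[X]}) : V :=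
  \sum_(x <- msupp z) z@_x *: f x.

Variable f : X -> V.

Lemma malg_linEw (d : {fset X}) z : (msupp z `<=` d)%fset ->
  malg_lin f z = \sum_(x <- d) z@_x *: f x.
Proof.
move=> le; rewrite [LHS](big_fset_incl _ le) => //= x xd /mcoeff_outdom ->.
by rewrite scale0r.
Qed.

Lemma malg_lin_is_linear : linear (malg_lin f).
Proof.
move=> c x y; pose d := (msupp x `|` msupp y `|` msupp (c *: x + y))%fset.
have dx : (msupp x `<=` d)%fset by rewrite /d -fsetUA fsubsetUl.
have dy : (msupp y `<=` d)%fset by rewrite /d -fsetUA fsetUCA fsubsetUl.
have dz : (msupp (c *: x + y) `<=` d)%fset by rewrite /d fsubsetUr.
rewrite (malg_linEw dx) (malg_linEw dy) (malg_linEw dz).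
rewrite scaler_sumr -big_split /=; apply: eq_bigr => i _.
by rewrite mcoeffD mcoeffZ scalerDl scalerA.
Qed.

HB.instance Definition _ :=
  GRing.isLinear.Build k {malg k[X]} V *:%R (malg_lin f) malg_lin_is_linear.

Lemma malg_linU x : malg_lin f << x >> = f x.
Proof. by rewrite (malg_linEw msuppU_le) big_seq_fset1 mcoeffUU scale1r. Qed.

End LinearExtension.

Lemma malg_lin_ext (k : fieldType) (X : choiceType) (V : lmodType k)
    (f g : {linear {malg k[X]} -> V}) :
  (forall x, f << x >> = g << x >>) -> f =1 g.
Proof.
move=> fg z; rewrite [z]monalgE !linear_sum; apply: eq_bigr => x _.
have -> : << z@_x *g x >> = z@_x *: << x >> :> {malg k[X]}.
  by apply/malgP => y; rewrite mcoeffZ !mcoeffU mulrnAr mulr1.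
by rewrite !linearZ fg.
Qed.

(* The group algebra k[G] is [{malg k[G]}] with this product; the library only
   provides one for monomial monoids, which groups are not. *)
Definition ga_mul (k : fieldType) (G : groupType) (x y : {malg k[G]}) :
    {malg k[G]} :=
  malg_lin (fun g => malg_lin (fun h => << (g * h)%g >>) y) x.

Definition ga_act (k : fieldType) (G : groupType) (V : lmodType k)
    (rho : representation G V) (x : {malg k[G]}) (v : V) : V :=
  malg_lin (fun g => rho g v) x.

Section QuotientModule.
Variables (k : fieldType) (M : lmodType k) (R : M -> Prop).

Inductive span : M -> Prop :=
| Span0 : span 0
| SpanS c r x : R r -> span x -> span (c *: r + x).

Definition in_span : {pred M} := fun x => `[< span x >].

Lemma spanD x y : span x -> span y -> span (x + y).
Proof.
by elim=> [|c r z Rr _ IH] sy; rewrite ?add0r // -addrA; apply: SpanS (IH sy).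
Qed.

Lemma spanZ a x : span x -> span (a *: x).
Proof.
elim=> [|c r z Rr _ IH]; first by rewrite scaler0; apply: Span0.
by rewrite scalerDr scalerA; apply: SpanS.
Qed.

Lemma in_span_closed : zmod_closed in_span.
Proof.
split=> [|x y /asboolP sx /asboolP sy]; first exact/asboolP/Span0.
by apply/asboolP/spanD; rewrite -?scaleN1r //; apply: spanZ.
Qed.

HB.instance Definition _ := GRing.isZmodClosed.Build M in_span in_span_closed.

Definition modq := Quotient.quot in_span.
HB.instance Definition _ := GRing.Zmodule.on modq.

Definition modq_pi (x : M) : modq := \pi_modq x.

Lemma modq_piP x y : modq_pi x = modq_pi y <-> span (x - y).
Proof.
split=> [/eqP|xy].
  by rewrite /modq_pi -Quotient.idealrBE => /asboolP.
by apply/eqP; rewrite /modq_pi -Quotient.idealrBE; apply/asboolP.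
Qed.

Lemma modq_piK q : modq_pi (repr q) = q.
Proof. exact: reprK. Qed.

Lemma modq_piD x y : modq_pi (x + y) = modq_pi x + modq_pi y.
Proof. by rewrite /modq_pi !piE. Qed.

Definition modq_scale (c : k) (q : modq) : modq := modq_pi (c *: repr q).

Lemma modq_scaleE c x : modq_scale c (modq_pi x) = modq_pi (c *: x).
Proof.
by apply/modq_piP; rewrite -scalerBr; apply/spanZ/modq_piP; rewrite modq_piK.
Qed.

Lemma modq_scaleA a b q : modq_scale a (modq_scale b q) = modq_scale (a * b) q.
Proof. by rewrite -[q]modq_piK !modq_scaleE scalerA. Qed.

Lemma modq_scale1 : left_id 1 modq_scale.
Proof. by move=> q; rewrite -[q]modq_piK modq_scaleE scale1r. Qed.

Lemma modq_scaleDr : right_distributive modq_scale +%R.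
Proof.
move=> c p q; rewrite -[p]modq_piK -[q]modq_piK.
by rewrite -modq_piD !modq_scaleE -modq_piD scalerDr.
Qed.

Lemma modq_scaleDl q : {morph modq_scale^~ q : a b / a + b}.
Proof.
by move=> a b; rewrite -[q]modq_piK !modq_scaleE -modq_piD scalerDl.
Qed.

HB.instance Definition _ := GRing.Zmodule_isLmodule.Build k modq
  modq_scaleA modq_scale1 modq_scaleDr modq_scaleDl.

Lemma modq_pi_is_linear : linear modq_pi.
Proof. by move=> c x y; rewrite modq_piD -modq_scaleE. Qed.

HB.instance Definition _ :=
  GRing.isLinear.Build k M modq *:%R modq_pi modq_pi_is_linear.

Lemma modq_pi0 x : R x -> modq_pi x = 0.
Proof.
move=> Rx; rewrite -(linear0 modq_pi); apply/modq_piP; rewrite subr0.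
by rewrite -[x]addr0 -[x]scale1r; apply: SpanS Span0.
Qed.

(* The map induced on the quotient by [f] (meaningful if [f] kills [R]). *)
Definition modq_lift (V : lmodType k) (f : M -> V) (q : modq) : V := f (repr q).

Lemma modq_liftE (V : lmodType k) (f : {linear M -> V}) x :
  (forall r, R r -> f r = 0) -> modq_lift f (modq_pi x) = f x.
Proof.
move=> fR; apply/eqP; rewrite -subr_eq0 -linearB; apply/eqP.
have : span (repr (modq_pi x) - x) by apply/modq_piP; rewrite modq_piK.
by elim=> [|c r z Rr _ IH]; rewrite ?linear0 // linearP fR // scaler0 add0r.
Qed.

End QuotientModule.

(* The tensor product of a right S-module M and a left S-module N over a
   k-algebra S: the free k-module on M * N modulo bilinearity and balancing.
   Only the actions [ra : M -> S -> M] and [la : S -> N -> N] enter. *)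
Section Tensor.
Variables (k : fieldType) (S : Type) (M N : lmodType k).
Variables (ra : M -> S -> M) (la : S -> N -> N).

Inductive tensor_rel : {malg k[(M * N)%type]} -> Prop :=
| TensorDl x y v : tensor_rel (<< (x + y, v) >> - << (x, v) >> - << (y, v) >>)
| TensorDr x v w : tensor_rel (<< (x, v + w) >> - << (x, v) >> - << (x, w) >>)
| TensorZl c x v : tensor_rel (<< (c *: x, v) >> - c *: << (x, v) >>)
| TensorZr c x v : tensor_rel (<< (x, c *: v) >> - c *: << (x, v) >>)
| TensorBal x s v : tensor_rel (<< (ra x s, v) >> - << (x, la s v) >>).

Definition tensor := modq tensor_rel.
HB.instance Definition _ := GRing.Lmodule.on tensor.

Definition tens (x : M) (v : N) : tensor := modq_pi tensor_rel << (x, v) >>.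

Lemma tens_rel0 z : tensor_rel z -> modq_pi tensor_rel z = 0.
Proof. exact: modq_pi0. Qed.

Lemma tensDl x y v : tens (x + y) v = tens x v + tens y v.
Proof.
have := tens_rel0 (TensorDl x y v); rewrite !linearB /= => /eqP.
by rewrite -addrA -opprD subr_eq0 => /eqP.
Qed.

Lemma tensDr x v w : tens x (v + w) = tens x v + tens x w.
Proof.
have := tens_rel0 (TensorDr x v w); rewrite !linearB /= => /eqP.
by rewrite -addrA -opprD subr_eq0 => /eqP.
Qed.

Lemma tensZl c x v : tens (c *: x) v = c *: tens x v.
Proof.
by have := tens_rel0 (TensorZl c x v); rewrite linearB linearZ /= => /eqP;
  rewrite subr_eq0 => /eqP.
Qed.

Lemma tensZr c x v : tens x (c *: v) = c *: tens x v.
Proof.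
by have := tens_rel0 (TensorZr c x v); rewrite linearB linearZ /= => /eqP;
  rewrite subr_eq0 => /eqP.
Qed.

Lemma tensBal x s v : tens (ra x s) v = tens x (la s v).
Proof.
by have := tens_rel0 (TensorBal x s v); rewrite linearB /= => /eqP;
  rewrite subr_eq0 => /eqP.
Qed.

Lemma tensor_ext (V : lmodType k) (f g : {linear tensor -> V}) :
  (forall x v, f (tens x v) = g (tens x v)) -> f =1 g.
Proof.
move=> fg q; rewrite -[q]modq_piK.
by apply: (malg_lin_ext (f := f \o modq_pi tensor_rel)
  (g := g \o modq_pi tensor_rel)) => -[x v]; apply: fg.
Qed.

(* The map x (x) v |-> f x (x) v induced by a right S-linear map [f]. *)
Definition tensor_mapl (f : M -> M) : tensor -> tensor :=
  modq_lift (malg_lin (fun p => tens (f p.1) p.2)).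

Section TensorMap.
Variable f : {linear M -> M}.
Hypothesis fS : forall x s, f (ra x s) = ra (f x) s.

Lemma tensor_mapl_rel r : tensor_rel r ->
  malg_lin (fun p : M * N => tens (f p.1) p.2) r = 0.
Proof.
case=> [x y v|x v w|c x v|c x v|x s v];
  rewrite ?linearB ?linearZ /= !malg_linU /= ?linearD ?linearZ ?fS
    ?tensDl ?tensDr ?tensZl ?tensZr ?tensBal ?subrr //.
- by rewrite -addrA -opprD subrr.
- by rewrite -addrA -opprD subrr.
- by rewrite -scalerDr subrr scaler0.
- by rewrite -scalerDr subrr scaler0.
Qed.

Lemma tensor_maplE x v : tensor_mapl f (tens x v) = tens (f x) v.
Proof.
rewrite /tensor_mapl /tens modq_liftE; last exact: tensor_mapl_rel.
exact: malg_linU.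
Qed.

Lemma tensor_mapl_is_linear : linear (tensor_mapl f).
Proof.
move=> c p q; rewrite -[p]modq_piK -[q]modq_piK -linearP /tensor_mapl.
by rewrite !modq_liftE ?linearP //; exact: tensor_mapl_rel.
Qed.

End TensorMap.

End Tensor.

Section Induction.
Variables (k : fieldType) (n : nat) (L : lmodType k).
Variable rho : representation (typeB n) L.

Local Notation A := (braid n.+1).
Local Notation B := (typeB n).

(* k[A_{n+1}] as a right k[B_n]-module, through k[B_n] -> k[A_{n+1}]. *)
Definition ga_incl (b : {malg k[B]}) : {malg k[A]} :=
  malg_lin (fun h : B => << val h >>) b.

Definition ga_ract (x : {malg k[A]}) (b : {malg k[B]}) : {malg k[A]} :=
  ga_mul x (ga_incl b).

Definition Ind := tensor ga_ract (ga_act rho).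
HB.instance Definition _ := GRing.Lmodule.on Ind.

Lemma ga_mulUE (a : A) (y : {malg k[A]}) :
  ga_mul << a >> y = malg_lin (fun h => << (a * h)%g >>) y.
Proof. exact: (malg_linU (fun g => malg_lin (fun h => << (g * h)%g >>) y)). Qed.

Lemma ga_mulU_linear (a : A) : linear (ga_mul << a >> : {malg k[A]} -> _).
Proof. by move=> c x y; rewrite !ga_mulUE; apply: malg_lin_is_linear. Qed.

Lemma ga_mulUU (a h : A) : ga_mul << a >> << h >> = << (a * h)%g >> :> {malg k[A]}.
Proof. by rewrite ga_mulUE; apply: (malg_linU (fun h => << (a * h)%g >>)). Qed.

HB.instance Definition _ (a : A) := GRing.isLinear.Build k {malg k[A]} {malg k[A]}
  *:%R (ga_mul << a >>) (ga_mulU_linear a).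

Lemma ga_mulUA (a : A) (x z : {malg k[A]}) :
  ga_mul << a >> (ga_mul x z) = ga_mul (ga_mul << a >> x) z.
Proof.
pose F g := malg_lin (fun h => << (g * h)%g >> : {malg k[A]}) z.
apply: (malg_lin_ext (f := ga_mul << a >> \o malg_lin F)
  (g := malg_lin F \o ga_mul << a >>)) => g.
rewrite /= ga_mulUU !(malg_linU F) /F.
apply: (malg_lin_ext (f := ga_mul << a >> \o malg_lin (fun h => << (g * h)%g >>))
  (g := malg_lin (fun h => << (a * g * h)%g >>))) => h.
rewrite /= (malg_linU (fun h => << (g * h)%g >>)) ga_mulUU.
by rewrite (malg_linU (fun h => << (a * g * h)%g >>)) mulgA.
Qed.

Definition Ind_act (a : A) : Ind -> Ind := tensor_mapl (ga_mul << a >>).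

Lemma Ind_act_comm (a : A) x b :
  ga_mul << a >> (ga_ract x b) = ga_ract (ga_mul << a >> x) b.
Proof. exact: ga_mulUA. Qed.

Lemma Ind_actE (a : A) x v : Ind_act a (tens _ _ x v) = tens _ _ (ga_mul << a >> x) v.
Proof. exact/tensor_maplE/Ind_act_comm. Qed.

HB.instance Definition _ (a : A) := GRing.isLinear.Build k Ind Ind *:%R
  (Ind_act a) (tensor_mapl_is_linear (@Ind_act_comm a)).

Lemma Ind_act1 q : Ind_act 1%g q = q.
Proof.
apply: (tensor_ext (f := Ind_act 1%g) (g := idfun)) => x v; rewrite /= Ind_actE.
have ga_mul1U h : ga_mul << 1%g >> << h >> = << h >> :> {malg k[A]}.
  by rewrite ga_mulUU mul1g.
by have /= -> := malg_lin_ext (f := ga_mul << 1%g >>) (g := idfun) ga_mul1U x.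
Qed.

Lemma Ind_actM a b q : Ind_act (a * b)%g q = Ind_act a (Ind_act b q).
Proof.
apply: (tensor_ext (f := Ind_act (a * b)%g) (g := Ind_act a \o Ind_act b)) => x v.
by rewrite /= !Ind_actE ga_mulUA ga_mulUU.
Qed.

Definition Ind_rep : representation A Ind :=
  @Representation k A Ind Ind_act Ind_act1 Ind_actM.

End Induction.

Definition is_comp N (s : seq nat) := all (leq 1) s && (sumn s == N).

(* A composition of N has at most N parts, each at most N; the bounds are there
   only to make the type finite (see [compositionP]). *)
Definition composition N :=
  {s : N.-bseq 'I_N.+1 | is_comp N [seq val x | x <- bseqval s]}.
HB.instance Definition _ N := Finite.on (composition N).

Definition parts N (c : composition N) : seq nat :=
  [seq val x | x <- bseqval (val c)].

Lemma parts_is_comp N (c : composition N) : is_comp N (parts c).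
Proof. exact: (valP c). Qed.

Lemma compositionP N s : is_comp N s -> exists c : composition N, parts c = s.
Proof.
move=> cs; case/andP: (cs) => pos /eqP sumN.
have size_le : forall u, all (leq 1) u -> (size u <= sumn u)%N.
  by elim=> //= x u IH /andP [x1 /IH]; lia.
have part_le : forall u x, x \in u -> (x <= sumn u)%N.
  by elim=> //= y u IH x; rewrite inE => /orP [/eqP->|/IH]; lia.
pose t := [seq (inord x : 'I_N.+1) | x <- s].
have vt : [seq val x | x <- t] = s.
  rewrite /t -map_comp -[RHS]map_id; apply/eq_in_map => x xs /=.
  by rewrite inordK // ltnS -sumN part_le.
have st : (size t <= N)%N by rewrite size_map -sumN size_le.
have ct : is_comp N [seq val x | x <- bseqval (Bseq st)] by rewrite vt.
by exists (exist _ (Bseq st) ct).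
Qed.

Definition part (lam : seq nat) m := nth 0%N lam m.

Definition offset (lam : seq nat) m := sumn (take m lam).

Definition merge m (lam : seq nat) : seq nat :=
  take m lam ++ (part lam m + part lam m.+1)%N :: drop m.+2 lam.

Lemma merge_is_comp N lam m : (m.+1 < size lam)%N -> is_comp N lam ->
  is_comp N (merge m lam) /\ size (merge m lam) = (size lam).-1.
Proof.
move=> lt_m /andP [pos sumN].
have e : lam = take m lam ++ part lam m :: part lam m.+1 :: drop m.+2 lam.
  rewrite -{1}(cat_take_drop m lam) (drop_nth 0%N) ?(ltnW lt_m) //.
  by rewrite (drop_nth 0%N lt_m).
rewrite /merge; move: (take m lam) (part lam m) (part lam m.+1) (drop m.+2 lam) e.
move=> s1 a b s2 e; move: pos sumN; rewrite e /is_comp !size_cat !all_cat !sumn_cat.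
move=> /= /and4P [-> a1 _ ->] /eqP <-; rewrite ltn_addr //; split; lia.
Qed.

Definition shuffle p q (g : 'S_(p + q)) : bool :=
  [forall x : 'I_(p + q), forall y : 'I_(p + q),
    ((x < y) && ((y < p) || (p <= x)))%N ==> (g x < g y)%N].

Definition sends m (g : 'S_m) (x y : nat) : bool :=
  [forall z : 'I_m, (z == x :> nat) ==> (g z == y :> nat)].

(* The ((p,h),q,j)-shuffles and the (p,(q,h),j)-shuffles. *)
Definition shuffle_l p h q j (g : 'S_(p + q)) : bool :=
  shuffle g && sends g (p + j) (h + j).
Definition shuffle_r p q h j (g : 'S_(p + q)) : bool :=
  shuffle g && sends g j (j + h).

(* The signed sum of [act] over the lifts of those permutations of the points
   in parts [m] and [m.+1] of [lam] that satisfy [P]. *)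
Definition lift_sum (k : fieldType) (T : lmodType k) N (act : braid N -> T)
    (lam : seq nat) m (P : pred 'S_(part lam m + part lam m.+1)) : T :=
  \sum_(g | P g) (-1) ^+ odd_perm g *: act (lift N (offset lam m) g).

(* A free abelian group on a finite basis tensored with T is the module of
   functions from the basis to T. *)
Section ComplexC.
Variables (k : fieldType) (N : nat) (T : lmodType k).
Variable rho : representation (braid N) T.

Definition C_basis q := {c : composition N | (size (parts c) + N == q)%N}.
HB.instance Definition _ q := Finite.on (C_basis q).

Definition C_mod q := {ffun C_basis q -> T}.
HB.instance Definition _ q := GRing.Lmodule.on (C_mod q).

(* lam (x) t; it is only used for [lam] a composition in the basis. *)
Definition C_tens q (lam : seq nat) (t : T) : C_mod q :=
  [ffun b => if parts (val b) == lam then t else 0].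

Definition C_diff_gen q (lam : seq nat) (t : T) : C_mod q :=
  \sum_(0 <= m < (size lam).-1)
    (-1) ^+ m *: C_tens q (merge m lam)
      (lift_sum (fun a => rho a t) (@shuffle (part lam m) (part lam m.+1))).

Definition C_diff q (x : C_mod q.+1) : C_mod q :=
  \sum_(b : C_basis q.+1) C_diff_gen q (parts (val b)) (x b).

End ComplexC.

Section ComplexD.
Variables (k : fieldType) (n : nat) (L : lmodType k).
Variable rho : representation (typeB n) L.

Definition D_basis q :=
  {b : composition n.+1 * 'I_n.+1 * 'I_n.+1 |
    let lam := parts b.1.1 in
    [&& size lam + n == q.+1, b.1.2 < size lam & b.2 < part lam b.1.2]%N}.
HB.instance Definition _ q := Finite.on (D_basis q).

Definition D_mod q := {ffun D_basis q -> L}.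
HB.instance Definition _ q := GRing.Lmodule.on (D_mod q).

Definition D_tens q (lam : seq nat) (i j : nat) (l : L) : D_mod q :=
  [ffun b : D_basis q => let: (c, i', j') := val b in
    if [&& parts c == lam, i' == i :> nat & j' == j :> nat] then l else 0].

Definition D_diff_gen q (lam : seq nat) (i j : nat) (l : L) : D_mod q :=
  let iota : 'I_n.+1 := inord (offset lam i + j) in
  let act a := rho (eta iota a) l in
  \sum_(0 <= m < i.-1)
    (-1) ^+ m *: D_tens q (merge m lam) i.-1 j
      (lift_sum act (@shuffle (part lam m) (part lam m.+1)))
  + \sum_(i.+1 <= m < (size lam).-1)
    (-1) ^+ m *: D_tens q (merge m lam) i j
      (lift_sum act (@shuffle (part lam m) (part lam m.+1)))
  + (if (0 < i)%N then
      (-1) ^+ i.-1 *: \sum_(0 <= h < (part lam i.-1).+1)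
        D_tens q (merge i.-1 lam) i.-1 (j + h)
          (lift_sum act
            (@shuffle_l (part lam i.-1) h (part lam i.-1.+1) j))
     else 0)
  + (if (i.+1 < size lam)%N then
      (-1) ^+ i *: \sum_(0 <= h < (part lam i.+1).+1)
        D_tens q (merge i lam) i (j + h)
          (lift_sum act (@shuffle_r (part lam i) (part lam i.+1) h j))
     else 0).

Definition D_diff q (x : D_mod q.+1) : D_mod q :=
  \sum_(b : D_basis q.+1) let: (c, i, j) := val b in D_diff_gen q (parts c) i j (x b).

End ComplexD.

(* Main.v *)
From HB Require Import structures.
Require Import Defs.
From mathcomp Require Import all_boot all_order all_fingroup all_algebra.
From mathcomp Require Import finmap zify ssrAC.
From mathcomp.multinomials Require Import monalg.

Import GRing.Theory.
Local Open Scope ring_scope.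
Set Implicit Arguments.
Unset Strict Implicit.
Unset Printing Implicit Defensive.

(** The braids [alpha n p] represent the left cosets of the type B group in
the braid group, so the induced module is the direct sum, over the points [p],
of copies [alpha n p (x) L] of L.  An element lam (x) (alpha_p (x) l) of the
complex C is thus a composition with one marked point and a vector of L; naming
the marked point by the part [i] that contains it and its place [j] in that part
turns it into the element (lam, i, j) (x) l of D.  This is the isomorphism in
each degree ([D_to_CK], [C_to_DK]).

It commutes with the differentials because
  a alpha_p = alpha_(a(p)) eta_p(a),
so that a braid [a] acts on alpha_p (x) l by moving the mark to a(p) and applying
eta_p(a) to l ([Ind_act_gen]).  The lift of a shuffle only permutes the strands
of the two parts being merged.  If neither contains the mark, the mark keeps its
place in its part, which gives the first two sums in the differential of D
([diff_far]).  If one of them does, its place j in that part becomes the place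
j + h in the merged part, where h counts the points of the other part that the
shuffle puts before the mark; sorting the shuffles by h ([sum_shuffle_l],
[sum_shuffle_r]) gives the last two sums ([diff_left], [diff_right]). *)

(** * Braids and their permutations *)

Lemma val_adj m i (x : 'I_m) : (i.+1 < m)%N ->
  val (adj m i x) =
    if x == i :> nat then i.+1 else if x == i.+1 :> nat then i else x.
Proof.
move=> im; rewrite (@adjE _ i (Ordinal (ltnW im)) (Ordinal im)) //.
by case: tpermP => [->|->|/eqP + /eqP]; rewrite -?val_eqE /= ?eqxx //;
  [case: eqP => //; lia | move=> /negPf -> /negPf ->].
Qed.

Lemma word_perm_shift_in N off m (w : seq nat) (x : 'I_N) (y : 'I_m) :
  (off + m <= N)%N -> valid_word m w -> val x = (off + y)%N ->
  val (word_perm N (map (addn off) w) x) = (off + word_perm m w y)%N.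
Proof.
move=> le_mN; elim: w => [|i w IH] /=; first by rewrite !perm1.
case/andP=> im vw xy; rewrite !permM val_adj; last lia.
by rewrite IH // -addnS !eqn_add2l val_adj // !(fun_if (addn off)).
Qed.

Lemma word_perm_shift_out N off m (w : seq nat) (x : 'I_N) :
  (off + m <= N)%N -> valid_word m w -> (x < off)%N || (off + m <= x)%N ->
  word_perm N (map (addn off) w) x = x.
Proof.
move=> le_mN + xout; elim: w => [|i w IH] /=; first by rewrite perm1.
case/andP=> im /IH xw; rewrite permM xw; apply/val_inj; rewrite val_adj; last lia.
by do 2!(case: ifP => [/eqP|_]; first lia).
Qed.

Lemma bperm_prod_sigma N (w : seq nat) :
  bperm (\prod_(i <- w) sigma N i)%g = word_perm N w.
Proof.
elim: w => [|i w IH]; first by rewrite big_nil bperm1.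
by rewrite big_cons bpermM IH bperm_sigma.
Qed.

Lemma bperm_lift N off m (g : 'S_m) :
  bperm (Defs.lift N off g) = word_perm N (map (addn off) (reduced_word g)).
Proof. by rewrite /Defs.lift -bperm_prod_sigma big_map. Qed.

Lemma reduced_wordP m (g : 'S_m) : reduced g (reduced_word g).
Proof. exact: projT2. Qed.

Lemma bperm_lift_in N off m (g : 'S_m) (x : 'I_N) (y : 'I_m) :
  (off + m <= N)%N -> val x = (off + y)%N ->
  val (bperm (Defs.lift N off g) x) = (off + g y)%N.
Proof.
have [vw wg _] := reduced_wordP g.
by move=> le xy; rewrite bperm_lift (word_perm_shift_in le vw xy) wg.
Qed.

Lemma bperm_lift_out N off m (g : 'S_m) (x : 'I_N) :
  (off + m <= N)%N -> (x < off)%N || (off + m <= x)%N ->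
  bperm (Defs.lift N off g) x = x.
Proof.
have [vw _ _] := reduced_wordP g.
by move=> le xout; rewrite bperm_lift (word_perm_shift_out le vw xout).
Qed.

(** * Images of a point under shuffles *)

(** Within either block a shuffle is strictly increasing, hence its values grow
at least as fast as the index. *)
Lemma shuffle_gap p q (g : 'S_(p + q)) (x y : 'I_(p + q)) :
  shuffle g -> (x <= y)%N -> ((y < p) || (p <= x))%N -> (y - x <= g y - g x)%N
  /\ (g x <= g y)%N.
Proof.
move=> /forallP sh; move e: (y - x)%N => d; elim: d y e => [|d IH] y e xy blk.
  by have -> : x = y by apply/val_inj => /=; lia.
have ym : (y.-1 < p + q)%N by have := ltn_ord y; lia.
have [] := IH (Ordinal ym); rewrite /=; try lia.
move: (forallP (sh (Ordinal ym)) y) => /=.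
have -> : (((y.-1 < y) && ((y < p) || (p <= y.-1))))%N by lia.
by move=> /=; lia.
Qed.

Lemma sendsE m (g : 'S_m) (x : 'I_m) z : sends g x z = (g x == z :> nat).
Proof.
apply/forallP/idP => [/(_ x)|gx y]; first by rewrite eqxx.
by apply/implyP => /eqP/val_inj ->.
Qed.

(** A point of a block only moves past points of the other block: this is
[shuffle_gap] between that point and the two ends of its block. *)
Lemma shuffle_bound_r p q (g : 'S_(p + q)) (x : 'I_(p + q)) :
  shuffle g -> (x < p)%N -> (x <= g x <= x + q)%N.
Proof.
move=> sh xp.
have m0 : (0 < p + q)%N by lia.
have m1 : (p.-1 < p + q)%N by lia.
have [] := @shuffle_gap p q g (Ordinal m0) x sh; rewrite /=; try lia.
have [] := @shuffle_gap p q g x (Ordinal m1) sh; rewrite /=; try lia.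
by have := ltn_ord (g (Ordinal m1)); lia.
Qed.

Lemma shuffle_bound_l p q (g : 'S_(p + q)) (x : 'I_(p + q)) :
  shuffle g -> (p <= x)%N -> (x - p <= g x <= x)%N.
Proof.
move=> sh px; have xm := ltn_ord x.
have m0 : (p < p + q)%N by lia.
have m1 : ((p + q).-1 < p + q)%N by lia.
have [] := @shuffle_gap p q g (Ordinal m0) x sh; rewrite /=; try lia.
have [] := @shuffle_gap p q g x (Ordinal m1) sh; rewrite /=; try lia.
by have := ltn_ord (g (Ordinal m1)); lia.
Qed.

(** Let h be the number of points of the other block that a shuffle puts before
the marked point.  It lies between 0 and the size of that block, so sorting the
shuffles by h uses each of them exactly once. *)
Lemma sum_shuffle_r (V : zmodType) p q j (F : 'S_(p + q) -> V) : (j < p)%N ->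
  \sum_(g | shuffle g) F g =
  \sum_(0 <= h < q.+1) \sum_(g | shuffle_r h j g) F g.
Proof.
move=> jp; have jm : (j < p + q)%N by lia.
(* [inord] loses nothing, by [shuffle_bound_r]. *)
pose nb_before (g : 'S_(p + q)) : 'I_q.+1 := inord (g (Ordinal jm) - j).
rewrite big_mkord (partition_big nb_before xpredT) //=.
apply: eq_bigr => h _; apply: eq_bigl => g; rewrite /shuffle_r /nb_before.
case sh: (shuffle g) => //=; rewrite (@sendsE _ g (Ordinal jm)) /=.
have := @shuffle_bound_r _ _ _ (Ordinal jm) sh jp; rewrite /= => b.
by rewrite -val_eqE /= inordK; lia.
Qed.

Lemma sum_shuffle_l (V : zmodType) p q j (F : 'S_(p + q) -> V) : (j < q)%N ->
  \sum_(g | shuffle g) F g =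
  \sum_(0 <= h < p.+1) \sum_(g | shuffle_l h j g) F g.
Proof.
move=> jq; have jm : (p + j < p + q)%N by lia.
(* [inord] loses nothing, by [shuffle_bound_l]. *)
pose nb_before (g : 'S_(p + q)) : 'I_p.+1 := inord (g (Ordinal jm) - j).
rewrite big_mkord (partition_big nb_before xpredT) //=.
apply: eq_bigr => h _; apply: eq_bigl => g; rewrite /shuffle_l /nb_before.
case sh: (shuffle g) => //=; rewrite (@sendsE _ g (Ordinal jm)) /=.
have := @shuffle_bound_l _ _ _ (Ordinal jm) sh (leq_addr _ _); rewrite /= => b.
by rewrite -val_eqE /= inordK; lia.
Qed.

(** * Coset decomposition of the induced module *)

Section TensorLift.
Variables (k : fieldType) (S : Type) (M N V : lmodType k).
Variables (ra : M -> S -> M) (la : S -> N -> N) (B : M * N -> V).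
Hypothesis B_linear_l : forall v, linear (fun x => B (x, v)).
Hypothesis B_linear_r : forall x, linear (fun v => B (x, v)).
Hypothesis B_balanced : forall x s v, B (ra x s, v) = B (x, la s v).

(** Each defining relation of the tensor product is one of the identities
assumed of [B]; this makes [modq_lift] of [B] independent of representatives. *)
Lemma tensor_lift_rel r : tensor_rel ra la r -> malg_lin B r = 0.
Proof.
have addE (U W : lmodType k) (f : U -> W) (fl : linear f) u v : f (u + v) = f u + f v.
  by have [_ ->] := GRing.nmod_morphism_semilinear (GRing.semilinear_linear fl).
case=> [x y v|x v w|c x v|c x v|x s v];
  rewrite ?linearB ?linearZ /= !malg_linU.
- by rewrite (addE _ _ _ (B_linear_l v)) addrAC addrK subrr.
- by rewrite (addE _ _ _ (B_linear_r x)) addrAC addrK subrr.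
- by rewrite (GRing.scalable_linear (B_linear_l v)) scalerN subrr.
- by rewrite (GRing.scalable_linear (B_linear_r x)) scalerN subrr.
- by rewrite B_balanced subrr.
Qed.

Lemma tensor_liftE x v : modq_lift (malg_lin B) (tens ra la x v) = B (x, v).
Proof. by rewrite /tens modq_liftE /= ?malg_linU //; exact: tensor_lift_rel. Qed.

Lemma tensor_lift_linear : linear (modq_lift (malg_lin B) : tensor ra la -> V).
Proof.
move=> c p q; rewrite -[p]modq_piK -[q]modq_piK -linearP.
by rewrite !modq_liftE ?linearP //; exact: tensor_lift_rel.
Qed.

End TensorLift.

Section InducedModule.
Variables (k : fieldType) (n : nat) (L : lmodType k).
Variable rho : representation (typeB n) L.

(** The inclusion of the summand alpha_i (x) L. *)
Definition ind_gen (i : 'I_n.+1) (v : L) : Ind rho :=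
  tens (@ga_ract k n) (ga_act rho) << alpha n i >> v.

Lemma ind_gen_linear i : linear (ind_gen i).
Proof. by move=> c u v; rewrite /ind_gen tensDr tensZr. Qed.

HB.instance Definition _ i :=
  GRing.isLinear.Build k L (Ind rho) *:%R (ind_gen i) (ind_gen_linear i).

Lemma ga_actU (b : typeB n) (v : L) : ga_act rho << b >> v = rho b v.
Proof. exact: (malg_linU (fun g => rho g v)). Qed.

Lemma ga_ractUU (a : braid n.+1) (b : typeB n) :
  ga_ract << a >> << b >> = << (a * val b)%g >> :> {malg k[braid n.+1]}.
Proof.
rewrite /ga_ract /ga_incl.
by rewrite (malg_linU (fun h : typeB n => << val h >> : {malg k[braid n.+1]})) ga_mulUU.
Qed.

(** By definition of eta, a alpha_i = alpha_(a(i)) eta_i(a), and the last factor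
passes through the tensor sign. *)
Lemma Ind_act_gen (a : braid n.+1) i (v : L) :
  Ind_act a (ind_gen i v) = ind_gen (bperm a i) (rho (eta i a) v).
Proof.
rewrite /ind_gen Ind_actE ga_mulUU -ga_actU -tensBal ga_ractUU /=.
by rewrite !mulgA mulgV mul1g.
Qed.

Lemma alpha_max : alpha n (@ord_max n) = 1%g.
Proof. by rewrite /alpha big_geq. Qed.

(** As alpha of the last point is trivial, eta at this point is the factor in
B_n of a braid with respect to its coset representative. *)
Lemma tens_braid (a : braid n.+1) (v : L) :
  tens (@ga_ract k n) (ga_act rho) << a >> v =
  ind_gen (bperm a ord_max) (rho (eta ord_max a) v).
Proof. by rewrite -Ind_act_gen /ind_gen Ind_actE ga_mulUU alpha_max mulg1. Qed.

(** The component in alpha_i (x) L of a (x) v, as a function of v: the braid [a]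
lies in the coset of alpha_i exactly when it sends the last point to [i]. *)
Definition coset_fun (i : 'I_n.+1) (a : braid n.+1) : {linear L -> L} :=
  if bperm a ord_max == i then rho (eta ord_max a) else \0.

Definition coset_pairing i (p : {malg k[braid n.+1]} * L) : L :=
  malg_lin (fun a => coset_fun i a p.2) p.1.

Lemma coset_pairing_linear_r i x c u v :
  coset_pairing i (x, c *: u + v) =
  c *: coset_pairing i (x, u) + coset_pairing i (x, v).
Proof.
rewrite /coset_pairing /malg_lin scaler_sumr -big_split /=.
by apply: eq_bigr => a _; rewrite linearP scalerDr !scalerA mulrC.
Qed.

Lemma coset_pairing_balanced i x s v :
  coset_pairing i (ga_ract x s, v) = coset_pairing i (x, ga_act rho s v).
Proof.
pose F a := coset_fun i a v.
pose I := fun h : typeB n => << val h >> : {malg k[braid n.+1]}.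
pose M a := fun h : braid n.+1 => << (a * h)%g >> : {malg k[braid n.+1]}.
pose R g := rho g v.
apply: (malg_lin_ext
  (f := malg_lin F \o malg_lin (fun a => malg_lin (M a) (malg_lin I s)))
  (g := malg_lin (fun a => coset_fun i a (malg_lin R s)))) => a.
rewrite /= (malg_linU (fun a => malg_lin (M a) _)).
rewrite (malg_linU (fun a => coset_fun i a _)).
apply: (malg_lin_ext (f := malg_lin F \o malg_lin (M a) \o malg_lin I)
  (g := coset_fun i a \o malg_lin R)) => b.
rewrite /= (malg_linU I) (malg_linU (M a)) (malg_linU F) (malg_linU R) /F /R.
have bmax : bperm (val b) ord_max = ord_max by apply/eqP/(valP b).
rewrite /coset_fun bpermM permM bmax; case: eqP => //= _.
rewrite -rep_actM; congr (rho _ v); apply/val_inj => /=.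
by rewrite bpermM permM bmax alpha_max !mulg1 mulgA.
Qed.

Lemma coset_pairing_linear_l i v : linear (fun x => coset_pairing i (x, v)).
Proof. by move=> c x y; apply: (malg_lin_is_linear (fun a => coset_fun i a v)). Qed.

Definition coset_coord i : Ind rho -> L := modq_lift (malg_lin (coset_pairing i)).

Lemma coset_coord_tensor i x v :
  coset_coord i (tens (@ga_ract k n) (ga_act rho) x v) = coset_pairing i (x, v).
Proof.
apply: tensor_liftE => *; [exact: coset_pairing_linear_l |
  exact: coset_pairing_linear_r | exact: coset_pairing_balanced].
Qed.

Lemma coset_coord_linear i : linear (coset_coord i).
Proof.
apply: tensor_lift_linear => *; [exact: coset_pairing_linear_l |
  exact: coset_pairing_linear_r | exact: coset_pairing_balanced].
Qed.

HB.instance Definition _ i :=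
  GRing.isLinear.Build k (Ind rho) L *:%R (coset_coord i) (coset_coord_linear i).

Lemma coset_coord_tens i a v :
  coset_coord i (tens (@ga_ract k n) (ga_act rho) << a >> v) = coset_fun i a v.
Proof.
rewrite coset_coord_tensor.
by apply: (malg_linU (fun a => coset_fun i a v)).
Qed.

Lemma eta_max_alpha (i : 'I_n.+1) : eta ord_max (alpha n i) = 1%g :> typeB n.
Proof. by apply/val_inj => /=; rewrite bperm_alpha mulVg alpha_max mulg1. Qed.

Lemma coset_coord_gen i p v : coset_coord i (ind_gen p v) = if p == i then v else 0.
Proof.
rewrite coset_coord_tens /coset_fun bperm_alpha.
by case: eqP => //= _; rewrite eta_max_alpha rep_act1.
Qed.

Definition coset_sum (z : Ind rho) : Ind rho := \sum_i ind_gen i (coset_coord i z).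

Lemma coset_sum_linear : linear coset_sum.
Proof.
move=> c u v; rewrite /coset_sum scaler_sumr -big_split /=.
by apply: eq_bigr => i _; rewrite !linearP.
Qed.

HB.instance Definition _ :=
  GRing.isLinear.Build k (Ind rho) (Ind rho) *:%R coset_sum coset_sum_linear.

Definition tens_left v x : Ind rho := tens (@ga_ract k n) (ga_act rho) x v.

Lemma tens_left_linear v : linear (tens_left v).
Proof. by move=> c x y; rewrite /tens_left tensDl tensZl. Qed.

HB.instance Definition _ v :=
  GRing.isLinear.Build k _ (Ind rho) *:%R (tens_left v) (tens_left_linear v).

Lemma coset_sumE z : \sum_i ind_gen i (coset_coord i z) = z.
Proof.
apply: (tensor_ext (f := coset_sum) (g := idfun)) => x v.
apply: (malg_lin_ext (f := coset_sum \o tens_left v) (g := tens_left v)) => a /=.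
rewrite /tens_left tens_braid /coset_sum (bigD1 (bperm a ord_max)) //= big1 ?addr0.
  by rewrite coset_coord_gen eqxx.
by move=> i /negPf ne; rewrite coset_coord_gen eq_sym ne linear0.
Qed.

End InducedModule.

(** * Merging two adjacent parts of a composition *)

Lemma offsetS lam m : offset lam m.+1 = (offset lam m + part lam m)%N.
Proof.
elim: lam m => [|x lam IH] [|m] //=; first by rewrite /offset /= take0 /= addn0.
by rewrite /offset /= -/(offset lam m.+1) IH addnA.
Qed.

Lemma offset_mono lam : {homo offset lam : i j / (i <= j)%N}.
Proof.
by apply: homo_leq => [//|y x z|m]; [exact: leq_trans | rewrite offsetS leq_addr].
Qed.

Lemma offset_le_sumn lam m : (offset lam m <= sumn lam)%N.
Proof. by rewrite -[lam in sumn lam](cat_take_drop m) sumn_cat leq_addr. Qed.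

Section Merge.
Variables (lam : seq nat) (m : nat).
Hypothesis mlt : (m.+1 < size lam)%N.

Let sz_take : size (take m lam) = m. Proof. by rewrite size_takel //; lia. Qed.

Lemma offset_merge_le i : (i <= m)%N -> offset (Defs.merge m lam) i = offset lam i.
Proof.
by move=> im; rewrite /offset /Defs.merge takel_cat ?sz_take // take_takel.
Qed.

Lemma part_merge_lt i : (i < m)%N -> part (Defs.merge m lam) i = part lam i.
Proof. by move=> im; rewrite /part /Defs.merge nth_cat sz_take im nth_take. Qed.

Lemma part_merge : part (Defs.merge m lam) m = (part lam m + part lam m.+1)%N.
Proof. by rewrite {1}/part /Defs.merge nth_cat sz_take ltnn subnn. Qed.

Lemma part_merge_gt i : (m < i)%N -> part (Defs.merge m lam) i = part lam i.+1.
Proof.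
move=> mi; rewrite {1}/part /Defs.merge nth_cat sz_take ltnNge ltnW //=.
have -> : (i - m = (i - m.+1).+1)%N by lia.
by rewrite /= nth_drop -[RHS]/(nth 0%N lam i.+1); congr nth; lia.
Qed.

Lemma offset_merge_gt i : (m < i)%N -> offset (Defs.merge m lam) i = offset lam i.+1.
Proof.
elim: i => // i IH; rewrite ltnS leq_eqVlt => /predU1P [<-|mi].
  by rewrite offsetS part_merge offset_merge_le // !offsetS addnA.
by rewrite offsetS IH // part_merge_gt // -offsetS.
Qed.

End Merge.

(** * Points of a composition *)

Section Points.
Variables (n q : nat).

Definition cparts (c : C_basis n.+1 q.+2) : seq nat := parts (val c).

Lemma sumn_cparts c : sumn (cparts c) = n.+1.
Proof. by have /andP [_ /eqP] := parts_is_comp (val c). Qed.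

Lemma size_parts N (c : composition N) : (size (parts c) <= N)%N.
Proof. by rewrite size_map; apply: size_bseq. Qed.

Lemma part_le_sumn lam i : (part lam i <= sumn lam)%N.
Proof.
by rewrite (leq_trans _ (offset_le_sumn lam i.+1)) // offsetS leq_addl.
Qed.

(** A point of {0, ..., n} lies at a definite place in a definite part of a
composition of n + 1; these are the coordinates of its position in the
concatenation of the parts. *)
Definition point_part (c : C_basis n.+1 q.+2) (p : 'I_n.+1) : 'I_n.+1 :=
  inord (reshape_index (cparts c) p).
Definition point_offset (c : C_basis n.+1 q.+2) (p : 'I_n.+1) : 'I_n.+1 :=
  inord (reshape_offset (cparts c) p).

Lemma val_point_part c p : val (point_part c p) = reshape_index (cparts c) p.
Proof.
rewrite /= inordK // (leq_trans _ (size_parts (val c))) // reshape_indexP //.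
by rewrite sumn_cparts.
Qed.

Lemma val_point_offset c p : val (point_offset c p) = reshape_offset (cparts c) p.
Proof.
rewrite /= inordK // (@leq_trans (part (cparts c) (reshape_index (cparts c) p))) //.
  by rewrite reshape_offsetP // sumn_cparts.
by have := part_le_sumn (cparts c) (reshape_index (cparts c) p); rewrite sumn_cparts.
Qed.

Lemma point_subproof c p :
  let b := (val c, point_part c p, point_offset c p) in
  let lam := parts b.1.1 in
  [&& size lam + n == q.+1, b.1.2 < size lam & b.2 < part lam b.1.2]%N.
Proof.
rewrite /= val_point_part val_point_offset -/(cparts c) reshape_indexP ?sumn_cparts //.
rewrite reshape_offsetP ?sumn_cparts //= andbT.
by have := valP c; rewrite /= addnS eqSS.
Qed.

Definition point c p : D_basis n q :=
  Sub (val c, point_part c p, point_offset c p) (point_subproof c p).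

Lemma point_comp_subproof (b : D_basis n q) :
  (size (parts (val b).1.1) + n.+1 == q.+2)%N.
Proof. by have /and3P [] := valP b; rewrite addnS eqSS. Qed.

Definition point_comp (b : D_basis n q) : C_basis n.+1 q.+2 :=
  Sub (val b).1.1 (point_comp_subproof b).

Definition point_pos (b : D_basis n q) : 'I_n.+1 :=
  inord (offset (parts (val b).1.1) (val b).1.2 + (val b).2).

Lemma offset_part_lt N lam i j : is_comp N lam -> (j < part lam i)%N ->
  (offset lam i + j < N)%N.
Proof.
move=> /andP [_ /eqP <-] jlt; apply: leq_trans (offset_le_sumn lam i.+1).
by rewrite offsetS ltn_add2l.
Qed.

Lemma val_point_pos b :
  val (point_pos b) = (offset (parts (val b).1.1) (val b).1.2 + (val b).2)%N.
Proof.
rewrite /= inordK // offset_part_lt ?parts_is_comp //.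
by have /and3P [] := valP b.
Qed.

Lemma point_compK c p : point_comp (point c p) = c.
Proof. exact/val_inj. Qed.

Lemma point_posK c p : point_pos (point c p) = p.
Proof.
apply/val_inj; rewrite val_point_pos val_point_part val_point_offset.
exact: reshape_indexK.
Qed.

Lemma pointK b : point (point_comp b) (point_pos b) = b.
Proof.
have /and3P [_ _ jlt] := valP b.
apply/val_inj; rewrite [RHS]surjective_pairing [(val b).1]surjective_pairing.
congr (_, _, _); apply/val_inj; rewrite ?val_point_part ?val_point_offset val_point_pos.
  exact: flatten_indexKl.
exact: flatten_indexKr.
Qed.

Lemma sum_points (V : zmodType) (F : C_basis n.+1 q.+2 -> 'I_n.+1 -> V) :
  \sum_c \sum_p F c p = \sum_b F (point_comp b) (point_pos b).
Proof.
rewrite pair_bigA /= (reindex (fun b => (point_comp b, point_pos b))) //.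
exists (fun cp => point cp.1 cp.2) => [b _|[c p] _] /=; first exact: pointK.
by rewrite point_compK point_posK.
Qed.

End Points.

(** * The isomorphism of complexes *)

(** The merges that involve part [i] are those with indices i - 1 and i; isolating
them puts the differential of C in the shape of that of D. *)
Lemma sum_around (V : zmodType) i s (F : nat -> V) : (i <= s)%N ->
  \sum_(0 <= m < s) F m =
  \sum_(0 <= m < i.-1) F m + \sum_(i.+1 <= m < s) F m
  + (if (0 < i)%N then F i.-1 else 0) + (if (i < s)%N then F i else 0).
Proof.
move=> le_is; rewrite (big_cat_nat (leq0n i) le_is) /=.
have -> : \sum_(0 <= m < i) F m =
    \sum_(0 <= m < i.-1) F m + (if (0 < i)%N then F i.-1 else 0).
  by case: (i) => [|i'] /=; rewrite ?big_nat_recr // big_geq // addr0.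
have -> : \sum_(i <= m < s) F m =
    (if (i < s)%N then F i else 0) + \sum_(i.+1 <= m < s) F m.
  by case: ltnP => si; [exact: big_ltn | rewrite !big_geq ?addr0 //; lia].
by rewrite (AC (2*2) (1*4*2*3)).
Qed.

Lemma ffun_linE (k : fieldType) (A : finType) (V : lmodType k) c (x y : {ffun A -> V}) a :
  (c *: x + y) a = c *: x a + y a.
Proof. by rewrite !ffunE. Qed.

Section CTens.
Variables (k : fieldType) (N : nat) (T : lmodType k) (q : nat).

Lemma C_tens_linear lam : linear (@C_tens k N T q lam).
Proof.
move=> c t u; apply/ffunP => b; rewrite !ffunE.
by case: ifP => _; rewrite ?scaler0 ?addr0.
Qed.

HB.instance Definition _ lam :=
  GRing.isLinear.Build k T (C_mod N T q) *:%R (@C_tens k N T q lam) (C_tens_linear lam).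

Variable rho : representation (braid N) T.

Lemma lift_sum_linear lam m (P : pred 'S_(part lam m + part lam m.+1)) :
  linear (fun t => lift_sum (fun a => rho a t) P).
Proof.
move=> c t u; rewrite /lift_sum scaler_sumr -big_split /=.
by apply: eq_bigr => g _; rewrite linearP scalerDr !scalerA mulrC.
Qed.

Lemma C_diff_gen_linear lam : linear (C_diff_gen rho q lam).
Proof.
move=> c t u; rewrite /C_diff_gen scaler_sumr -big_split /=.
apply: eq_bigr => m _; rewrite lift_sum_linear C_tens_linear.
by rewrite scalerDr !scalerA mulrC.
Qed.

HB.instance Definition _ lam :=
  GRing.isLinear.Build k T (C_mod N T q) *:%R (C_diff_gen rho q lam)
    (C_diff_gen_linear lam).

End CTens.

(* Permutation types mention [part]; simplification must not unfold it there. *)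
Arguments part : simpl never.

(** The isomorphism rests on the decomposition of the induced module into copies
of L that braids permute as [act_gen] says; [M] is any module so decomposed. *)
Section Isomorphism.
Variables (k : fieldType) (n : nat) (L M : lmodType k).
Variables (rho : representation (typeB n) L) (rhoM : representation (braid n.+1) M).
Variables (gen : 'I_n.+1 -> {linear L -> M}) (coord : 'I_n.+1 -> {linear M -> L}).
Hypothesis coord_gen : forall i p v, coord i (gen p v) = if p == i then v else 0.
Hypothesis gen_coord : forall z, \sum_i gen i (coord i z) = z.
Hypothesis act_gen : forall a i v,
  rhoM a (gen i v) = gen (bperm a i) (rho (eta i a) v).

Definition D_to_C q (x : D_mod n L q) : C_mod n.+1 M q.+2 :=
  [ffun c => \sum_p gen p (x (point c p))].

Definition C_to_D q (y : C_mod n.+1 M q.+2) : D_mod n L q :=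
  [ffun b => coord (point_pos b) (y (point_comp b))].

Lemma D_to_CE q (x : D_mod n L q) c :
  D_to_C x c = \sum_p gen p (x (point c p)).
Proof. exact: ffunE. Qed.

Lemma C_to_DE q (y : C_mod n.+1 M q.+2) b :
  C_to_D y b = coord (point_pos b) (y (point_comp b)).
Proof. exact: ffunE. Qed.

Lemma D_to_C_linear q : linear (@D_to_C q).
Proof.
move=> c x y; apply/ffunP => b.
rewrite [RHS]ffun_linE !D_to_CE.
rewrite scaler_sumr -big_split /=.
by apply: eq_bigr => p _; rewrite ffun_linE linearP.
Qed.

HB.instance Definition _ q := GRing.isLinear.Build k (D_mod n L q)
  (C_mod n.+1 M q.+2) *:%R (@D_to_C q) (@D_to_C_linear q).

Lemma D_to_CK q : cancel (@D_to_C q) (@C_to_D q).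
Proof.
move=> x; apply/ffunP => b; rewrite C_to_DE D_to_CE linear_sum /=.
rewrite (bigD1 (point_pos b)) //= big1 ?addr0 ?coord_gen ?eqxx ?pointK //.
by move=> p /negPf ne; rewrite coord_gen ne.
Qed.

Lemma C_to_DK q : cancel (@C_to_D q) (@D_to_C q).
Proof.
move=> y; apply/ffunP => c; rewrite D_to_CE -[RHS]gen_coord.
by apply: eq_bigr => p _; rewrite C_to_DE point_posK point_compK.
Qed.

Lemma D_to_C_tens q lam i j l :
  is_comp n.+1 lam -> (j < part lam i)%N ->
  D_to_C (D_tens n q lam i j l) =
  C_tens n.+1 q.+2 lam (gen (inord (offset lam i + j)) l).
Proof.
move=> lam_comp jlt; apply/ffunP => c; rewrite !ffunE.
have off_lt := offset_part_lt lam_comp jlt.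
case: eqP => [cl|cl]; last first.
  rewrite big1 // => p _; rewrite ffunE /= -/(cparts c).
  by case: eqP => //= _; rewrite linear0.
have pE p : (p == inord (offset lam i + j)) =
    (point_part c p == i :> nat) && (point_offset c p == j :> nat).
  rewrite -[X in _ = X && _]/(val (point_part c p) == i).
  rewrite -[X in _ = _ && X]/(val (point_offset c p) == j).
  rewrite val_point_part val_point_offset /cparts cl -val_eqE /= inordK //.
  apply/eqP/andP => [->|[/eqP <- /eqP <-]]; last by rewrite -{1}(reshape_indexK lam p).
  by rewrite [reshape_index _ _]flatten_indexKl // [reshape_offset _ _]flatten_indexKr.
rewrite (bigD1 (inord (offset lam i + j))) //= big1 ?addr0.
  by rewrite ffunE /= cl eqxx /= -pE eqxx.
by move=> p /negPf ne; rewrite ffunE /= cl eqxx /= -pE ne linear0.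
Qed.

Lemma lift_sum_gen lam m (P : pred 'S_(part lam m + part lam m.+1)) (x y : 'I_n.+1) l :
  (forall g, P g -> bperm (Defs.lift n.+1 (offset lam m) g) x = y) ->
  lift_sum (fun a => rhoM a (gen x l)) P =
  gen y (lift_sum (fun a => rho (eta x a) l) P).
Proof.
move=> xy; rewrite /lift_sum linear_sum; apply: eq_bigr => g Pg.
by rewrite linearZ /= -(xy g Pg) -act_gen.
Qed.

Section Generator.
Variables (q : nat) (lam : seq nat) (i j : nat) (l : L).
Hypothesis lam_comp : is_comp n.+1 lam.
Hypotheses (ilt : (i < size lam)%N) (jlt : (j < part lam i)%N).

Let iota : 'I_n.+1 := inord (offset lam i + j).
Let act a := rho (eta iota a) l.
Let ind_act a := rhoM a (gen iota l).

Let iotaE : val iota = (offset lam i + j)%N.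
Proof. by rewrite /= inordK // (offset_part_lt lam_comp jlt). Qed.

Let offset_le m : (offset lam m <= n.+1)%N.
Proof. by have /andP [_ /eqP <-] := lam_comp; exact: offset_le_sumn. Qed.

Let parts_le m : (offset lam m + (part lam m + part lam m.+1) <= n.+1)%N.
Proof. by rewrite addnA -!offsetS. Qed.

(* Part [i], which contains the mark, lies outside the two merged parts. *)
Let iota_far m g : (m.+1 < i)%N || (i < m)%N ->
  bperm (Defs.lift n.+1 (offset lam m) (g : 'S_(part lam m + part lam m.+1))) iota = iota.
Proof.
move=> mi; apply: bperm_lift_out => //; rewrite iotaE addnA -!offsetS.
case/orP: mi => mi; apply/orP; [right|left].
  by rewrite (leq_trans (offset_mono lam mi)) ?leq_addr.
by rewrite (leq_trans _ (offset_mono lam mi)) // offsetS ltn_add2l.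
Qed.

Lemma diff_far m i' : (m.+1 < size lam)%N ->
  offset (Defs.merge m lam) i' = offset lam i ->
  part (Defs.merge m lam) i' = part lam i ->
  (m.+1 < i)%N || (i < m)%N ->
  D_to_C ((-1) ^+ m *: D_tens n q (Defs.merge m lam) i' j
      (lift_sum act (@shuffle (part lam m) (part lam m.+1)))) =
  (-1) ^+ m *: C_tens n.+1 q.+2 (Defs.merge m lam)
      (lift_sum ind_act (@shuffle (part lam m) (part lam m.+1))).
Proof.
move=> mlt offE partE mi; have [mcomp _] := merge_is_comp mlt lam_comp.
rewrite linearZ /= D_to_C_tens ?partE // offE.
by rewrite (@lift_sum_gen lam m _ iota iota) // => g _; apply: iota_far.
Qed.

Lemma diff_right : (i.+1 < size lam)%N ->
  D_to_C ((-1) ^+ i *: \sum_(0 <= h < (part lam i.+1).+1)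
      D_tens n q (Defs.merge i lam) i (j + h)
        (lift_sum act (@shuffle_r (part lam i) (part lam i.+1) h j))) =
  (-1) ^+ i *: C_tens n.+1 q.+2 (Defs.merge i lam)
      (lift_sum ind_act (@shuffle (part lam i) (part lam i.+1))).
Proof.
move=> mlt; have [mcomp _] := merge_is_comp mlt lam_comp.
rewrite linearZ linear_sum /=; congr (_ *: _).
rewrite /(lift_sum ind_act) (sum_shuffle_r _ jlt) linear_sum.
apply: eq_big_nat => h /andP [_ hle].
have pt : (j + h < part (Defs.merge i lam) i)%N by rewrite part_merge //; lia.
rewrite D_to_C_tens //; congr C_tens; symmetry.
apply: lift_sum_gen => g /andP [_].
have jm : (j < part lam i + part lam i.+1)%N by lia.
rewrite (@sendsE _ g (Ordinal jm)) => /eqP gj; apply/val_inj.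
rewrite (@bperm_lift_in _ _ _ _ _ (Ordinal jm)) // gj.
by rewrite /= inordK ?offset_merge_le // -[X in (X + _ < _)%N](offset_merge_le mlt) //
  (offset_part_lt mcomp pt).
Qed.

Lemma diff_left : (0 < i)%N ->
  D_to_C ((-1) ^+ i.-1 *: \sum_(0 <= h < (part lam i.-1).+1)
      D_tens n q (Defs.merge i.-1 lam) i.-1 (j + h)
        (lift_sum act (@shuffle_l (part lam i.-1) h (part lam i.-1.+1) j))) =
  (-1) ^+ i.-1 *: C_tens n.+1 q.+2 (Defs.merge i.-1 lam)
      (lift_sum ind_act (@shuffle (part lam i.-1) (part lam i.-1.+1))).
Proof.
move=> i0; have mlt : (i.-1.+1 < size lam)%N by rewrite prednK.
have jlt' : (j < part lam i.-1.+1)%N by rewrite prednK.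
have [mcomp _] := merge_is_comp mlt lam_comp.
rewrite linearZ linear_sum /=; congr (_ *: _).
rewrite /(lift_sum ind_act) (sum_shuffle_l _ jlt') linear_sum.
apply: eq_big_nat => h /andP [_ hle].
have pt : (j + h < part (Defs.merge i.-1 lam) i.-1)%N by rewrite part_merge //; lia.
rewrite D_to_C_tens //; congr C_tens; symmetry.
apply: lift_sum_gen => g /andP [_].
have jm : (part lam i.-1 + j < part lam i.-1 + part lam i.-1.+1)%N by lia.
rewrite (@sendsE _ g (Ordinal jm)) => /eqP gj; apply/val_inj.
rewrite (@bperm_lift_in _ _ _ _ _ (Ordinal jm)) ?gj //; last first.
  by rewrite iotaE addnA -offsetS prednK.
rewrite /= inordK ?offset_merge_le //; first by rewrite [(h + j)%N]addnC.
by rewrite -[X in (X + _ < _)%N](offset_merge_le mlt) // (offset_part_lt mcomp pt).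
Qed.

Lemma D_to_C_diff_gen :
  D_to_C (D_diff_gen rho q lam i j l) = C_diff_gen rhoM q.+2 lam (gen iota l).
Proof.
rewrite /D_diff_gen -/iota /C_diff_gen (@sum_around _ i (size lam).-1); last by lia.
have -> : (i < (size lam).-1)%N = (i.+1 < size lam)%N by lia.
rewrite !linearD; congr (_ + _ + _ + _).
- rewrite linear_sum; apply: eq_big_nat => m /andP [_ mi].
  have mlt : (m.+1 < size lam)%N by lia.
  apply: diff_far => //; last by lia.
    by rewrite offset_merge_gt // prednK //; lia.
  by rewrite part_merge_gt // prednK //; lia.
- rewrite linear_sum; apply: eq_big_nat => m /andP [im ms].
  have mlt : (m.+1 < size lam)%N by lia.
  apply: diff_far => //; last by rewrite im orbT.
    by rewrite offset_merge_le // ltnW.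
  by rewrite part_merge_lt.
- by case: ifP => [/diff_left|_]; rewrite ?linear0.
- by case: ifP => [/diff_right|_]; rewrite ?linear0.
Qed.

End Generator.

Lemma D_to_C_diff q (x : D_mod n L q.+1) :
  D_to_C (D_diff rho x) = C_diff rhoM (D_to_C x).
Proof.
rewrite /D_diff linear_sum /C_diff.
under [RHS]eq_bigr => c _ do rewrite D_to_CE linear_sum.
rewrite (sum_points (fun c p =>
  C_diff_gen rhoM q.+2 (parts (val c)) (gen p (x (point c p))))).
apply: eq_bigr => b _; rewrite pointK /point_comp /point_pos.
case: b => [[[c i] j] b_ok] /=; case/and3P: (b_ok) => _ ilt jlt.
exact: D_to_C_diff_gen (parts_is_comp c) ilt jlt.
Qed.

End Isomorphism.

Theorem proposition4p10 (k : fieldType) (n : nat) (hn : (1 <= n)%N)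
    (L : lmodType k) (rho : representation (typeB n) L) :
  exists phi : forall q : nat, {linear D_mod n L q -> C_mod n.+1 (Ind rho) q.+2},
    (forall q : nat, bijective (phi q)) /\
    (forall (q : nat) (x : D_mod n L q.+1),
       phi q (D_diff rho x) = C_diff (Ind_rep rho) (phi q.+1 x)).
Proof.
pose gen i : {linear L -> Ind rho} := ind_gen rho i.
pose coord i : {linear Ind rho -> L} := @coset_coord k n L rho i.
exists (fun q => @D_to_C k n L (Ind rho) gen q); split=> [q|q x].
  exists (@C_to_D k n L (Ind rho) coord q).
    exact: (@D_to_CK k n L (Ind rho) gen coord (@coset_coord_gen k n L rho)).
  exact: (@C_to_DK k n L (Ind rho) gen coord (@coset_sumE k n L rho)).
exact: (@D_to_C_diff k n L (Ind rho) rho (Ind_rep rho) gen (@Ind_act_gen k n L rho)).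
Qed.
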